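(* Let $\mathcal{H}$ be a real Hilbert space, let $A\colon \mathcal{H}\rightrightarrows\mathcal{H}$ be maximally monotone and let $B\colon \mathcal{H}\to\mathcal{H}$ be monotone with $(A+B)^{-1}(0)\neq\varnothing$. Suppose $\alpha\in[0,1)$, $\beta\in(0,1]$, $\lambda>0$ and either (a) $B$ is $L$-Lipschitz and $\lambda < \min\left\{\frac{2-\beta -\alpha \beta -2\alpha}{2L}, \frac{1-\alpha-\alpha\beta}{\beta L}\right\}$, or (b) $B$ is $(1/L)$-cocoercive, $\alpha<\frac{2-\beta}{2+\beta}$ and $\lambda < \min\left\{ \frac{2-\beta -\alpha \beta + 2\alpha}{2L},\frac{1-\alpha+\alpha\beta}{\beta L}\right\}$. Given $x_0,x_{-1}\in\mathcal{H}$, define sequences $(x_k)$, $(z_k)$ by $$z_{k+1} := J_{\lambda A}\Bigl( x_k - \lambda B(x_k) - \frac{\lambda}{\beta}(B(x_k)- B(x_{k-1})) + \frac{\alpha}{\beta}(x_k-x_{k-1}) \Bigr),\qquad x_{k+1} := (1-\beta) x_k + \beta z_{k+1}$$ for all $k\in\mathbb{N}$. Then $(x_k)$ converges weakly to a point in $(A+B)^{-1}(0)$.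
   Context: $J_{\lambda A}:=(I+\lambda A)^{-1}$ is the resolvent. $B$ is $\beta'$-cocoercive if $\langle x-y,B(x)-B(y)\rangle\geq\beta'\|B(x)-B(y)\|^2$ for all $x,y$; here $\beta'=1/L$. *)

(* Defs.v *)
From mathcomp Require Import all_boot all_order all_algebra.
From mathcomp Require Import all_classical all_reals all_analysis.
Set Implicit Arguments. Unset Strict Implicit. Unset Printing Implicit Defensive.
Import Order.TTheory GRing.Theory Num.Theory.
Import numFieldNormedType.Exports.
Local Open Scope classical_set_scope.
Local Open Scope ring_scope.

Definition ipnorm (R : realType) (H : lmodType R) (ip : H -> H -> R) (x : H) : R :=
  Num.sqrt (ip x x).

Record is_hilbert (R : realType) (H : lmodType R) (ip : H -> H -> R) : Prop := {
  ip_sym : forall x y, ip x y = ip y x;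
  ip_linl : forall (a : R) x y z, ip (a *: x + y) z = a * ip x z + ip y z;
  ip_ge0 : forall x, 0 <= ip x x;
  ip_eq0 : forall x, ip x x = 0 -> x = 0;
  ip_complete : forall u : nat -> H,
    (forall e : R, 0 < e -> exists N : nat, forall m n : nat,
        (N <= m)%N -> (N <= n)%N -> ipnorm ip (u m - u n) < e) ->
    exists l : H, forall e : R, 0 < e -> exists N : nat, forall n : nat,
        (N <= n)%N -> ipnorm ip (u n - l) < e
}.

(* Set-valued operators A : H ⇉ H are relations: A x u means u ∈ A(x). *)
Definition monotone_op (R : realType) (H : lmodType R) (ip : H -> H -> R)
  (A : H -> H -> Prop) : Prop :=
  forall x u y v, A x u -> A y v -> 0 <= ip (x - y) (u - v).

Definition maximally_monotone (R : realType) (H : lmodType R) (ip : H -> H -> R)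
  (A : H -> H -> Prop) : Prop :=
  monotone_op ip A /\
  forall x u, (forall y v, A y v -> 0 <= ip (x - y) (u - v)) -> A x u.

Definition monotone_fun (R : realType) (H : lmodType R) (ip : H -> H -> R)
  (B : H -> H) : Prop :=
  forall x y, 0 <= ip (x - y) (B x - B y).

Definition lipschitz_op (R : realType) (H : lmodType R) (ip : H -> H -> R)
  (L : R) (B : H -> H) : Prop :=
  forall x y, ipnorm ip (B x - B y) <= L * ipnorm ip (x - y).

Definition cocoercive_op (R : realType) (H : lmodType R) (ip : H -> H -> R)
  (b : R) (B : H -> H) : Prop :=
  forall x y, b * (ipnorm ip (B x - B y)) ^+ 2 <= ip (x - y) (B x - B y).

(* z = J_{λA}(w)  iff  w ∈ z + λ A(z), i.e. (w - z)/λ ∈ A(z). *)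
Definition resolvent_rel (R : realType) (H : lmodType R)
  (lam : R) (A : H -> H -> Prop) (w z : H) : Prop :=
  A z (lam^-1 *: (w - z)).

Definition zero_of_sum (R : realType) (H : lmodType R)
  (A : H -> H -> Prop) (B : H -> H) (p : H) : Prop :=
  exists u, A p u /\ u + B p = 0.

Definition weakly_converges (R : realType) (H : lmodType R) (ip : H -> H -> R)
  (x : nat -> H) (p : H) : Prop :=
  forall v : H, (fun k => ip (x k) v) @ \oo --> ip p v.

(* Main.v *)
Require Import Defs.
From mathcomp Require Import all_boot all_order all_algebra.
From mathcomp Require Import all_classical all_reals all_analysis.
From mathcomp Require Import ring lra.
Import Order.TTheory GRing.Theory Num.Theory.
Import numFieldNormedType.Exports.
Set Implicit Arguments. Unset Strict Implicit.
Local Open Scope classical_set_scope.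
Local Open Scope ring_scope.

(* Both cases say that [C = lam B - alpha Id] is [kappa]-Lipschitz, with
   [kappa = lam L + alpha] in case (a) and [max (lam L - alpha) alpha] in case
   (b), where [2 kappa < 2 - beta - alpha beta] and [kappa beta < 1 - alpha].
   Writing [d_k = x_k - x_{k-1}], for every zero [p] the energy
     (1 - alpha)/2 |x_k - p|^2 - <x_k - p, C x_k - C x_{k-1}>
       + kappa/(2 beta) |d_k|^2 + lam (1 - beta) <x_k - p, B x_k - B p>
   is coercive by the second inequality and decreases, by the first one, by at
   least a multiple of [|d_{k+1}|^2 + <x_{k+1} - p, B x_{k+1} - B p>].  Hence
   [d_k -> 0] and [|x_k - p|] converges, and Opial's argument applies once weak
   cluster points are zeros.  Weak cluster points are limits along ultrafilters,
   obtained from the Riesz representation theorem.  If [x*], [w*] are the weak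
   limits of [x_k], [B x_k], maximality of [A] gives [- w* \in A x*] and
   maximality of [B] gives [w* = B x*], so the maximality of the sum [A + B],
   which would need Minty's theorem, is never used. *)

(** * Inner product inequalities *)

Section InnerProduct.
Variables (R : realType) (H : lmodType R) (ip : H -> H -> R).
Hypothesis hH : is_hilbert ip.

Lemma ipDl x y z : ip (x + y) z = ip x z + ip y z.
Proof. by rewrite -[x in LHS]scale1r (ip_linl hH) mul1r. Qed.

Lemma ip0l z : ip 0 z = 0.
Proof. by apply: (addrI (ip 0 z)); rewrite -ipDl !addr0. Qed.

Lemma ip0r z : ip z 0 = 0.
Proof. by rewrite (ip_sym hH) ip0l. Qed.

Lemma ipZl a x z : ip (a *: x) z = a * ip x z.
Proof. by rewrite -[a *: x]addr0 (ip_linl hH) ip0l addr0. Qed.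

Lemma ipNl x z : ip (- x) z = - ip x z.
Proof. by rewrite -scaleN1r ipZl mulN1r. Qed.

Lemma ipDr x y z : ip z (x + y) = ip z x + ip z y.
Proof. by rewrite !(ip_sym hH z) ipDl. Qed.

Lemma ipZr a x z : ip z (a *: x) = a * ip z x.
Proof. by rewrite !(ip_sym hH z) ipZl. Qed.

Lemma ipNr x z : ip z (- x) = - ip z x.
Proof. by rewrite !(ip_sym hH z) ipNl. Qed.

Definition ipE := (ipDl, ipDr, ipNl, ipNr, ipZl, ipZr).

Lemma ipnorm_sqr x : ipnorm ip x ^+ 2 = ip x x.
Proof. by rewrite /ipnorm sqr_sqrtr // (ip_ge0 hH). Qed.

Lemma ip_sub_eq0 x y : ip (x - y) (x - y) <= 0 -> x = y.
Proof.
move=> h; apply/eqP; rewrite -subr_eq0; apply/eqP/(ip_eq0 hH)/eqP.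
by rewrite eq_le h (ip_ge0 hH).
Qed.

Lemma ip_add_le x y : ip (x + y) (x + y) <= 2 * ip x x + 2 * ip y y.
Proof.
by have := ip_ge0 hH (x - y); rewrite !ipE (ip_sym hH y x); lra.
Qed.

Lemma ip_young c w s : 0 < s -> 2 * ip w c <= s * ip w w + ip c c / s.
Proof.
move=> s0; have := ip_ge0 hH (s *: w - c); rewrite !ipE (ip_sym hH c w) => h.
rewrite -(ler_pM2l s0) mulrDr (mulrCA _ (ip c c)) divff ?gt_eqF //; lra.
Qed.

(** Young's inequality with weight [k * s], so that both resulting terms carry the same factor
    [k]. *)
Lemma ip_young_lip k s c d w : 0 < k -> 0 < s -> ip c c <= k ^+ 2 * ip d d ->
  2 * ip w c <= k * (s * ip w w + ip d d / s).
Proof.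
move=> k0 s0 hc; apply: le_trans (ip_young c w (mulr_gt0 k0 s0)) _.
rewrite mulrDr mulrA lerD2l ler_pdivrMr ?mulr_gt0 //.
by rewrite (_ : k * _ * _ = k ^+ 2 * ip d d) //; field; rewrite gt_eqF.
Qed.

Lemma ip_cauchy_schwarz x y : ip x y ^+ 2 <= ip x x * ip y y.
Proof.
have [x0|x0] := eqVneq (ip x x) 0.
  by rewrite (ip_eq0 hH x0) !ip0l expr0n mul0r.
have xp : 0 < ip x x by rewrite lt_neqAle eq_sym x0 (ip_ge0 hH).
have := ip_ge0 hH (ip x x *: y - ip x y *: x).
rewrite !ipE (ip_sym hH y x) => h.
rewrite -(ler_pM2l xp) -subr_ge0; apply: le_trans h _.
by rewrite le_eqVlt; apply/orP; left; apply/eqP; ring.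
Qed.

Lemma lipschitz_sqr L B x y : lipschitz_op ip L B ->
  ip (B x - B y) (B x - B y) <= L ^+ 2 * ip (x - y) (x - y).
Proof.
move=> hB; rewrite -!ipnorm_sqr -exprMn lerXn2r ?nnegrE ?sqrtr_ge0 //.
by apply: le_trans (hB x y); exact: sqrtr_ge0.
Qed.

(** Young's inequality with weight [L] bounds the cocoercivity product; of the two copies of
    [|B x - B y|^2] that arise, one is absorbed. *)
Lemma cocoercive_lipschitz_sqr L B x y : 0 < L -> cocoercive_op ip L^-1 B ->
  ip (B x - B y) (B x - B y) <= L ^+ 2 * ip (x - y) (x - y).
Proof.
move=> L0 /(_ x y); rewrite ipnorm_sqr ler_pdivrMl // => h.
have := ip_young (B x - B y) (x - y) L0.
rewrite -(ler_pM2l L0) mulrDr (mulrCA _ (ip (B x - B y) _)) divff ?gt_eqF // => h2.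
lra.
Qed.

End InnerProduct.

(** * Limits of real functions along filters *)

Section RealLimits.
Context {R : realType} {T : Type} {F : set_system T} {FF : ProperFilter F}.
Implicit Types a d : T -> R.

Lemma cvg_eq1 a b (l : R) : a =1 b -> a @ F --> l -> b @ F --> l.
Proof. by move=> /funext ->. Qed.

Lemma cvg0_of_sqr_le a d M : (forall k, a k ^+ 2 <= M * d k) ->
  d @ F --> (0 : R) -> a @ F --> (0 : R).
Proof.
move=> had d0.
have h : (fun k => Num.sqrt (M * d k)) @ F --> (0 : R).
  rewrite -[X in _ --> X]sqrtr0; apply: continuous_cvg; first exact: sqrt_continuous.
  by rewrite -[X in _ --> X](mulr0 M); apply: cvgMl_tmp.
apply: (@squeeze_cvgr _ _ _ _ (fun k => - Num.sqrt (M * d k)) (fun k => Num.sqrt (M * d k))).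
- by apply: nearW => k; rewrite -ler_norml -sqrtr_sqr ler_wsqrtr.
- by rewrite -[X in _ --> X]oppr0; apply: cvgN.
- exact: h.
Qed.

(** Compactness of [[-M, M]] gives a cluster point, and an ultrafilter converges to each of its
    cluster points. *)
Lemma ultra_bounded_cvg a M : UltraFilter F -> (forall k, `|a k| <= M) ->
  cvg (a @ F).
Proof.
move=> FU aM.
have [|l [_ cl]] := @segment_compact R (- M) M (a @ F) _.
  by apply: nearW => k; rewrite /= in_itv /= -ler_norml.
apply/cvg_ex; exists l => V nV.
have [//|h] := in_ultra_setVsetC (a @^-1` V) FU.
have [y [ /= ]] := cl (~` V) V h nV.
by [].
Qed.

End RealLimits.

Lemma lyapunov_cvg {R : realType} (E D : nat -> R) :
  (forall k, 0 <= E k) -> (forall k, 0 <= D k) ->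
  (forall k, E k.+1 <= E k - D k.+1) ->
  cvg (E @ \oo) /\ (D @ \oo --> 0).
Proof.
move=> E0 D0 ED.
have cE : cvg (E @ \oo).
  apply: nonincreasing_is_cvgn.
    by apply/nonincreasing_seqP => n; apply: le_trans (ED n) _; rewrite gerBl.
  by exists 0 => _ [k _ <-].
split => //.
(* The energy inequality controls [D] only from index 1 on, hence the shift. *)
rewrite -cvg_shiftS /=.
have /cvg_ex[l El] := cE.
apply: (@squeeze_cvgr _ _ _ _ (fun=> 0) (fun k => E k - E k.+1)).
- by apply: nearW => k; rewrite D0 /=; have := ED k; lra.
- exact: cvg_cst.
- rewrite -(subrr l); apply: cvgB => //.
  by have := El; rewrite -cvg_shiftS.
Qed.

(** * Riesz representation and weak compactness *)

Section Hilbert.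
Variables (R : realType) (H : lmodType R) (ip : H -> H -> R).
Hypothesis hH : is_hilbert ip.

Lemma cvg_ip0 {T} {F : set_system T} {FF : ProperFilter F} (r y : T -> H) M :
  (forall k, ip (y k) (y k) <= M) ->
  ((fun k => ip (r k) (r k)) @ F --> (0 : R)) ->
  ((fun k => ip (r k) (y k)) @ F --> (0 : R)).
Proof.
move=> yM; apply: (cvg0_of_sqr_le (M := M)) => k.
apply: le_trans (ip_cauchy_schwarz hH _ _) _.
by rewrite mulrC ler_wpM2r // (ip_ge0 hH).
Qed.

(* The representing vector is the limit of a minimizing sequence of
   [q y = |y|^2 - 2 f y]; the parallelogram law makes it Cauchy. *)
Lemma riesz (f : H -> R) M :
  (forall a x y, f (a *: x + y) = a * f x + f y) ->
  (forall y, 2 * f y <= ip y y + M) ->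
  exists p, forall v, f v = ip p v.
Proof.
move=> flin fM.
pose q y := ip y y - 2 * f y.
have hinf : has_inf (range q).
  split; first by exists (q 0), 0.
  by exists (- M) => _ [y _ <-]; rewrite /q; have := fM y; lra.
set I := inf (range q).
have Ile y : I <= q y by apply: ge_inf; [case: hinf|exists y].
have [|y hy] := @choice _ _ (fun n z => q z < I + n.+1%:R^-1).
  move=> n; have e0 : 0 < n.+1%:R^-1 :> R by rewrite invr_gt0.
  have [_ [z _ <-] hz] := inf_adherent e0 hinf.
  by exists z.
have par u v : ip (u - v) (u - v) <= 2 * (q u - I) + 2 * (q v - I).
  (* The infimum is compared with [q] at the midpoint; the summand [0] fits the shape of [flin]. *)
  have := Ile (2^-1 *: u + (2^-1 *: v + 0)).
  rewrite /q !flin !(ipE hH) (ip_sym hH v u).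
  have f0 : f 0 = 0 by have := flin 1 0 0; rewrite scaler0 addr0; lra.
  rewrite !(ip0l hH) !(ip0r hH) f0; lra.
have cau e : 0 < e -> exists N : nat, forall n, (N <= n)%N -> n.+1%:R^-1 < e :> R.
  move=> e0; have [N _ hN] := near_infty_natSinv_lt (PosNum e0).
  by exists N => n Nn; exact: hN.
have [l hl] : exists l : H, forall e : R, 0 < e -> exists N : nat,
    forall n, (N <= n)%N -> ipnorm ip (y n - l) < e.
  apply: (ip_complete hH) => e e0.
  have [N hN] := cau (e ^+ 2 / 4) (divr_gt0 (exprn_gt0 _ e0) (ltr0Sn _ _)).
  exists N => m n Nm Nn.
  rewrite -(@ltr_pXn2r _ 2) // ?nnegrE ?sqrtr_ge0 ?ltW // (ipnorm_sqr hH).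
  apply: le_lt_trans (par _ _) _.
  have := hN _ Nm; have := hN _ Nn; have := hy m; have := hy n.
  by move: n.+1%:R^-1 m.+1%:R^-1 => a b; lra.
have l0 : ((fun n => ip (y n - l) (y n - l)) @ \oo --> (0 : R)).
  apply/cvgrPdist_lt => e e0.
  have [N hN] := hl (Num.sqrt e) (eqbRL (sqrtr_gt0 _) e0).
  exists N => // n /= /hN; rewrite sub0r normrN ger0_norm ?(ip_ge0 hH) //.
  rewrite -(@ltr_pXn2r _ 2) // ?nnegrE ?sqrtr_ge0 // (ipnorm_sqr hH).
  by rewrite sqr_sqrtr ?ltW.
have lv v : ((fun n => ip (y n) v) @ \oo --> ip l v).
  have h : ((fun n => ip (y n - l) v) @ \oo --> (0 : R)).
    by apply: (cvg_ip0 (M := ip v v)) l0.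
  rewrite -[X in _ --> X]addr0; apply: cvg_eq1 (cvgD (cvg_cst _) h) => n.
  by rewrite fctE (ipDl hH) (ipNl hH) addrC subrK.
exists l => v.
(* Minimality of [l] in the direction [v]; the slack [1/(n+1)] of the minimizing sequence vanishes
   in the limit. *)
have key t : 0 <= 2 * t * (ip l v - f v) + t ^+ 2 * ip v v.
  have c : ((fun n => 2 * t * (ip (y n) v - f v) + t ^+ 2 * ip v v + n.+1%:R^-1) @ \oo
      --> 2 * t * (ip l v - f v) + t ^+ 2 * ip v v + 0).
    apply: cvgD; last exact: cvg_harmonic.
    apply: cvgD; last exact: cvg_cst.
    apply: cvgMl_tmp; apply: cvgB => //; exact: cvg_cst.
  rewrite -[leRHS]addr0; apply: (cvgr_to_ge c); apply: nearW => n.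
  have := Ile (t *: v + y n); rewrite {1}/q flin !(ipE hH) (ip_sym hH v).
  by have := hy n; rewrite /q; move: n.+1%:R^-1 => c0; lra.
have vv := ip_ge0 hH v.
set g := ip l v - f v in key.
have : g = 0.
  (* The optimal [t] would be [- g / |v|^2]; the [+ 1] covers [v = 0]. *)
  have h := key (- g / (ip v v + 1)).
  have : 0 <= (2 * (- g / (ip v v + 1)) * g + (- g / (ip v v + 1)) ^+ 2 * ip v v) * (ip v v + 1) ^+ 2.
    by rewrite mulr_ge0 // sqr_ge0.
  rewrite (_ : _ * _ = - (g ^+ 2 * (ip v v + 2))); last by field; rewrite gt_eqF //; lra.
  rewrite oppr_ge0 pmulr_lle0; last by lra.
  by move=> g2; apply/eqP; rewrite -sqrf_eq0 eq_le g2 sqr_ge0.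
by rewrite /g; lra.
Qed.

(** The limits of [<x_k, v>] along [F] exist by boundedness and are linear in [v], so a vector
    represents them. *)
Lemma ultra_weak_cvg {T} {F : set_system T} (x : T -> H) M : UltraFilter F ->
  (forall k, ip (x k) (x k) <= M) ->
  exists p, forall v, ((fun k => ip (x k) v) @ F --> ip p v).
Proof.
move=> FU xM.
have PF : ProperFilter F by exact: ultra_proper.
have c v : cvg ((fun k => ip (x k) v) @ F).
  apply: (@ultra_bounded_cvg _ _ _ _ _ (M + ip v v)) => k.
  have vv := ip_ge0 hH v; have xx := ip_ge0 hH (x k).
  have := ip_young hH v (x k) ltr01; have := ip_young hH (- v) (x k) ltr01.
  have := xM k; rewrite ler_norml !(ipE hH) !divr1; lra.
have [||p hp] := @riesz (fun v => lim ((fun k => ip (x k) v) @ F)) M.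
- move=> a u v; apply: cvg_lim => //.
  apply: cvg_eq1 (cvgD (cvgM (cvg_cst a) (c u)) (c v)) => k.
  by rewrite fctE /= !(ipE hH).
- move=> v.
  have cv : (fun k => 2 * ip (x k) v) @ F --> 2 * lim ((fun k => ip (x k) v) @ F).
    apply: cvgM; [exact: cvg_cst|exact: c].
  apply: (cvgr_to_le cv); apply: nearW => k; have := ip_young hH v (x k) ltr01; have := xM k.
  rewrite divr1; lra.
by exists p => v; rewrite -hp; exact: c.
Qed.
End Hilbert.

(** * Weak limits and maximal monotonicity *)

Section Operators.
Variables (R : realType) (H : lmodType R) (ip : H -> H -> R).
Hypothesis hH : is_hilbert ip.
Variables (A : H -> H -> Prop) (B : H -> H) (L : R).
Hypothesis maxA : maximally_monotone ip A.
Hypothesis monB : monotone_fun ip B.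
Hypothesis L0 : 0 < L.
Hypothesis lipB : forall x y,
  ip (B x - B y) (B x - B y) <= L ^+ 2 * ip (x - y) (x - y).

(* Minty's trick: test against [y = x + t (w - B x)] for small [t]. *)
Lemma monotone_lipschitz_maximal x w :
  (forall y, 0 <= ip (x - y) (w - B y)) -> w = B x.
Proof.
move=> h; apply: (ip_sub_eq0 hH); set g := w - B x.
(* With this [t], Young's inequality gives [2 <g, c> <= |g|^2] for the increment [c] of [B], whereas
   [hg] gives [|g|^2 <= <g, c>]. *)
pose t := (2 * L)^-1.
have t0 : 0 < t by rewrite invr_gt0 mulr_gt0.
have hc := lipB (x + t *: g) x; have hg := h (x + t *: g).
rewrite (_ : x + t *: g - x = t *: g) in hc; last by rewrite addrC addKr.
rewrite (_ : x - (x + t *: g) = - (t *: g)) in hg; last by rewrite opprD addNKr.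
rewrite (_ : w - B (x + t *: g) = g - (B (x + t *: g) - B x)) in hg; last first.
  by rewrite /g opprB addrA subrK.
have hy := ip_young_lip hH g L0 t0 hc.
move: hg hy; set c := B _ - B x; clearbody c g.
rewrite (ipNl hH) (ipZl hH) -mulrN pmulr_rge0 // !(ipE hH).
have -> : L * (t * ip g g + t * (t * ip g g) / t) = ip g g.
  by rewrite /t; field; rewrite gt_eqF.
lra.
Qed.

(* Weak limits of [B X] and of a selection of [A] are taken jointly.  Testing
   maximality of [A] at [xs] shows that the defect
   [c - <xs, ws>] of the duality pairing is both [<= 0] and [>= 0]. *)
Lemma zero_of_weak_limit {T} {F : set_system T} {FF : ProperFilter F}
    (X Z U : T -> H) (M c : R) (xs ws : H) :
  (forall k, A (Z k) (U k)) ->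
  (forall k, ip (X k) (X k) <= M) ->
  (forall k, ip (B (X k)) (B (X k)) <= M) ->
  (fun k => ip (Z k - X k) (Z k - X k)) @ F --> (0 : R) ->
  (fun k => ip (U k + B (X k)) (U k + B (X k))) @ F --> (0 : R) ->
  (forall v, (fun k => ip (X k) v) @ F --> ip xs v) ->
  (forall v, (fun k => ip (B (X k)) v) @ F --> ip ws v) ->
  (fun k => ip (X k) (B (X k))) @ F --> c ->
  zero_of_sum A B xs.
Proof.
move=> AZU XM BM r0 s0 Xw Bw XBc.
have B_pos y : 0 <= c - ip xs (B y) - (ip ws y - ip y (B y)).
  have h : (fun k => ip (X k) (B (X k)) - ip (X k) (B y)
      - (ip (B (X k)) y - ip y (B y))) @ F
      --> c - ip xs (B y) - (ip ws y - ip y (B y)).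
    by apply: cvgB; apply: cvgB => //; exact: cvg_cst.
  apply: (cvgr_to_ge h); apply: nearW => k; have := monB (X k) y.
  by rewrite !(ipE hH) (ip_sym hH y (B (X k))); lra.
(* Monotonicity of [A] is expanded with [Z = X + r] and [U = s - B X]; every term with a factor [r]
   or [s] vanishes in the limit. *)
have A_pos y v : A y v -> 0 <= ip y v - c - ip xs v + ip ws y.
  move=> Ayv; pose r k := Z k - X k; pose s k := U k + B (X k).
  have rB : (fun k => ip (r k) (B (X k))) @ F --> (0 : R).
    by apply: (cvg_ip0 hH BM).
  have sX : (fun k => ip (s k) (X k)) @ F --> (0 : R).
    by apply: (cvg_ip0 hH XM).
  have rv : (fun k => ip (r k) v) @ F --> (0 : R).
    by apply: (@cvg_ip0 _ _ _ hH _ _ _ r (fun=> v) (ip v v)).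
  have sy : (fun k => ip (s k) y) @ F --> (0 : R).
    by apply: (@cvg_ip0 _ _ _ hH _ _ _ s (fun=> y) (ip y y)).
  have rs : (fun k => ip (r k) (s k)) @ F --> (0 : R).
    apply: (@cvg0_of_sqr_le _ _ _ _ _ (fun k => ip (r k) (r k) * ip (s k) (s k)) 1).
      by move=> k; rewrite mul1r (ip_cauchy_schwarz hH).
    by rewrite -[X in _ --> X](mulr0 0); apply: cvgM.
  have h : (fun k => (ip y v - ip (X k) (B (X k)) - ip (X k) v + ip (B (X k)) y)
     + (ip (s k) (X k) - ip (s k) y - ip (r k) (B (X k)) - ip (r k) v + ip (r k) (s k)))
    @ F --> (ip y v - c - ip xs v + ip ws y) + (0 - 0 - 0 - 0 + 0).
    by apply: cvgD; apply: cvgD => //; do ?[apply: cvgB => //]; exact: cvg_cst.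
  rewrite (_ : ip y v - c - ip xs v + ip ws y =
    (ip y v - c - ip xs v + ip ws y) + (0 - 0 - 0 - 0 + 0)); last by ring.
  apply: (cvgr_to_ge h); apply: nearW => k.
  have := maxA.1 _ _ _ _ (AZU k) Ayv; rewrite /r /s !(ipE hH).
  rewrite !(ip_sym hH (U k)) !(ip_sym hH (B (X k))); lra.
(* Since [c >= <xs, ws>], [A_pos] shows that [(xs, - ws)] is monotonically related to the graph of
   [A]. *)
have c_ge : 0 <= c - ip xs ws.
  by have := B_pos xs; rewrite (ip_sym hH ws); lra.
have Axw : A xs (- ws).
  apply: maxA.2 => y v /A_pos; rewrite !(ipE hH) (ip_sym hH y ws); lra.
(* The pair just found gives [c <= <xs, ws>], which turns [B_pos] into the test for [ws = B xs]. *)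
have c_le := A_pos _ _ Axw.
rewrite !(ipE hH) (ip_sym hH ws) in c_le.
exists (- ws); split => //; rewrite -(@monotone_lipschitz_maximal xs ws) ?addNr //.
by move=> y; have := B_pos y; rewrite !(ipE hH) (ip_sym hH y ws); lra.
Qed.

End Operators.

(** * The Lyapunov energy: coercivity and descent *)

Section Descent.
Variables (R : realType) (H : lmodType R) (ip : H -> H -> R).
Hypothesis hH : is_hilbert ip.
Variables alpha beta lam kappa : R.
Hypotheses (beta_gt0 : 0 < beta) (lam_gt0 : 0 < lam) (kappa_gt0 : 0 < kappa).

(* With [w = x_k - p], [d = x_k - x_{k-1}], [b = B x_k - B p] and
   [db = B x_k - B x_{k-1}], this is the Lyapunov function of the iteration. *)
Definition energy (w d b db : H) : R :=
  (1 - alpha) / 2 * ip w w - ip w (lam *: db - alpha *: d)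
  + kappa / (2 * beta) * ip d d + lam * (1 - beta) * ip w b.

(** Young's inequality with weight [beta] splits the cross term so that its [|d|^2] part is
    cancelled by the [kappa] term of the energy. *)
Lemma energy_ge w d b db : beta <= 1 ->
  ip (lam *: db - alpha *: d) (lam *: db - alpha *: d) <= kappa ^+ 2 * ip d d ->
  0 <= ip w b -> (1 - alpha - kappa * beta) / 2 * ip w w <= energy w d b db.
Proof.
move=> beta1 he wb; have := ip_young_lip hH w kappa_gt0 beta_gt0 he.
rewrite /energy; set e := _ - _.
have : 0 <= lam * (1 - beta) * ip w b.
  by rewrite !mulr_ge0 ?subr_ge0 // ltW.
rewrite (_ : kappa / (2 * beta) * _ = kappa * (ip d d / beta) / 2); last first.
  by field; rewrite gt_eqF.
lra.
Qed.

(** The second hypothesis is monotonicity of [A] between [z_{k+1}] and the zero [p], as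
    [w + d' / beta = z_{k+1} - p]. *)
Lemma energy_descent w d b db d' db' :
  ip (lam *: db - alpha *: d) (lam *: db - alpha *: d) <= kappa ^+ 2 * ip d d ->
  0 <= ip (w + beta^-1 *: d') (lam^-1 *: (- (beta^-1 *: d') - lam *: b
         - (lam / beta) *: db + (alpha / beta) *: d)) ->
  energy (w + d') d' (b + db') db' <= energy w d b db
    - ((2 - beta - alpha * beta - 2 * kappa) / (2 * beta) * ip d' d'
       + lam * beta * ip (w + d') (b + db')).
Proof.
move=> he hmon.
have := ip_young_lip hH (- d') kappa_gt0 ltr01 he.
rewrite -subr_ge0 => hy.
rewrite -subr_ge0.
have : 0 <= lam * beta * ip (w + beta^-1 *: d') (lam^-1 *: (- (beta^-1 *: d') - lam *: b
         - (lam / beta) *: db + (alpha / beta) *: d)).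
  by rewrite !mulr_ge0 // ltW.
have : 0 <= (2 * beta)^-1 * (kappa * (1 * ip (- d') (- d') + ip d d / 1) -
        2 * ip (- d') (lam *: db - alpha *: d)).
  by rewrite mulr_ge0 // invr_ge0 mulr_ge0 // ltW.
(* The claimed gap is identically [1 / (2 beta)] times the slack in Young's inequality plus
   [lam * beta] times the monotonicity product. *)
move=> h1 h2; apply: le_trans (addr_ge0 h1 h2) _.
rewrite le_eqVlt; apply/orP; left; apply/eqP.
rewrite /energy !(ipE hH) (ip_sym hH d' w).
by field; rewrite !gt_eqF.
Qed.

End Descent.

(** * Opial's lemma along ultrafilters *)

Section Opial.
Variables (R : realType) (H : lmodType R) (ip : H -> H -> R).
Hypothesis hH : is_hilbert ip.

(** For two cluster points, [|X k - p|^2 - |X k - p0|^2] is affine in [X k] and converges, so it has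
    the same value at [p] and at [p0]; this forces [p = p0]. *)
Lemma opial (X : nat -> H) (S : H -> Prop) :
  (forall p, S p -> cvg ((fun k => ip (X k - p) (X k - p)) @ \oo)) ->
  (forall F, UltraFilter F -> \oo `<=` F ->
     exists2 p, S p & forall v, (fun k => ip (X k) v) @ F --> ip p v) ->
  exists p, S p /\ weakly_converges ip X p.
Proof.
move=> Xcvg Xultra.
have [F0 [UF0 ooF0]] := @ultraFilterLemma _ (\oo : set_system nat) _.
have [p0 Sp0 Xp0] := Xultra _ UF0 ooF0.
exists p0; split=> // v; apply: contrapT => notcvg.
have [e e0 he] : exists2 e : R, 0 < e &
    ~ \forall k \near \oo, `|ip p0 v - ip (X k) v| < e.
  apply: contrapT => h; apply: notcvg; apply/cvgrPdist_lt => e e0.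
  by apply: contrapT => h2; apply: h; exists e.
(* If convergence fails, these indices meet every tail, so an ultrafilter refining [\oo] contains
   [B]; its weak limit is again [p0], against the definition of [B]. *)
pose B := [set k | ~ `|ip p0 v - ip (X k) v| < e].
have PB : ProperFilter (within B \oo).
  apply: Build_ProperFilter => h; apply: he.
  have := h; rewrite /within /=; by apply: filterS => k /= hk; exact: contrapT hk.
have [F [UF BF]] := @ultraFilterLemma _ _ PB.
have ooF : \oo `<=` F by move=> P hP; apply: BF; apply: (filterS _ hP) => k Pk _.
have PF : ProperFilter F by exact: ultra_proper.
have PF0 : ProperFilter F0 by exact: ultra_proper.
have FB : F B by apply: BF; rewrite /within /=; apply: nearW.
have [p Sp Xp] := Xultra _ UF ooF.
have pp0 : p = p0.
  apply: (ip_sub_eq0 hH).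
  have /cvg_ex[a ha] := Xcvg _ Sp; have /cvg_ex[b hb] := Xcvg _ Sp0.
  have lim_eq (G : set_system nat) (q : H) : ProperFilter G -> \oo `<=` G ->
      (forall v, (fun k => ip (X k) v) @ G --> ip q v) ->
      a - b = -2 * ip q (p - p0) + (ip p p - ip p0 p0).
    move=> PG ooG Xq.
    have h1 : (fun k => ip (X k - p) (X k - p) - ip (X k - p0) (X k - p0)) @ G --> a - b.
      by apply: cvgB; [apply: cvg_trans ha|apply: cvg_trans hb]; exact: cvg_app.
    have h2 : (fun k => -2 * ip (X k) (p - p0) + (ip p p - ip p0 p0)) @ G
        --> -2 * ip q (p - p0) + (ip p p - ip p0 p0).
      by apply: cvgD; [apply: cvgM; [exact: cvg_cst|exact: Xq]|exact: cvg_cst].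
    rewrite -(cvg_lim _ h1) //; apply: cvg_lim => //; apply: cvg_eq1 h2 => k.
    by rewrite !(ipE hH) !(ip_sym hH _ (X k)); ring.
  have := lim_eq F p PF ooF Xp; rewrite (lim_eq F0 p0 PF0 ooF0 Xp0).
  by rewrite !(ipE hH) (ip_sym hH p p0); lra.
rewrite pp0 in Xp.
have /cvgrPdist_lt/(_ e e0) near_F := Xp v.
have [k [ /= Bk /Bk]] := filter_ex (filterI FB near_F).
by [].
Qed.
End Opial.

(** * Convergence of the relaxed iteration *)

Section Iteration.
Variables (R : realType) (H : lmodType R) (ip : H -> H -> R).
Hypothesis hH : is_hilbert ip.
Variables (A : H -> H -> Prop) (B : H -> H).
Variables (alpha beta lam L kappa : R) (xs zs : nat -> H).
Hypothesis maxA : maximally_monotone ip A.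
Hypothesis monB : monotone_fun ip B.
Hypotheses (alpha_lt1 : alpha < 1) (beta_gt0 : 0 < beta) (beta_le1 : beta <= 1).
Hypotheses (lam_gt0 : 0 < lam) (L_gt0 : 0 < L) (kappa_gt0 : 0 < kappa).
Hypothesis lipB : forall x y,
  ip (B x - B y) (B x - B y) <= L ^+ 2 * ip (x - y) (x - y).
Hypothesis lipC : forall x y,
  ip (lam *: (B x - B y) - alpha *: (x - y)) (lam *: (B x - B y) - alpha *: (x - y))
    <= kappa ^+ 2 * ip (x - y) (x - y).
Hypothesis kappa_descent : 2 * kappa < 2 - beta - alpha * beta.
Hypothesis kappa_coercive : kappa * beta < 1 - alpha.
Hypothesis resolvent_step : forall k : nat,
  resolvent_rel lam A
    (xs k.+1 - lam *: B (xs k.+1) - (lam / beta) *: (B (xs k.+1) - B (xs k))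
       + (alpha / beta) *: (xs k.+1 - xs k))
    (zs k.+1).
Hypothesis relaxation_step :
  forall k : nat, xs k.+2 = (1 - beta) *: xs k.+1 + beta *: zs k.+1.

(** As [xs] starts at [x_{-1}], [xs k.+1] is [x_k] and [d k] is [x_k - x_{k-1}]. *)
Let d k := xs k.+1 - xs k.
Let db k := B (xs k.+1) - B (xs k).
Let e k := lam *: db k - alpha *: d k.
(** The element of [A (z_{k+1})] selected by the resolvent, with [z_{k+1} - x_k] rewritten as
    [d k.+1 / beta]. *)
Let u k := lam^-1 *: (- (beta^-1 *: d k.+1) - lam *: B (xs k.+1)
  - (lam / beta) *: db k + (alpha / beta) *: d k).

Lemma zsE k : zs k.+1 = xs k.+1 + beta^-1 *: d k.+1.
Proof.
rewrite /d relaxation_step scalerBl scale1r addrAC [_ - _ *: _ - _]addrAC subrr sub0r.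
rewrite addrC scalerDr scalerN !scalerA mulVf ?gt_eqF // !scale1r.
by rewrite addrC subrK.
Qed.

Lemma A_step k : A (zs k.+1) (u k).
Proof.
have := resolvent_step k; rewrite /resolvent_rel; congr (A _ (_ *: _)).
rewrite zsE opprD addrA -/(db k) -/(d k).
set a := lam *: _; set b := (lam / beta) *: _; set c := (alpha / beta) *: _.
by rewrite [LHS](ACl (1*5*6*2*3*4)%AC) /= subrr add0r.
Qed.

Lemma energy_step p k : zero_of_sum A B p ->
  energy ip alpha beta lam kappa (xs k.+2 - p) (d k.+1) (B (xs k.+2) - B p) (db k.+1)
  <= energy ip alpha beta lam kappa (xs k.+1 - p) (d k) (B (xs k.+1) - B p) (db k)
    - ((2 - beta - alpha * beta - 2 * kappa) / (2 * beta) * ip (d k.+1) (d k.+1)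
       + lam * beta * ip (xs k.+2 - p) (B (xs k.+2) - B p)).
Proof.
move=> [v [Apv /eqP]]; rewrite addr_eq0 => /eqP vE.
have -> : xs k.+2 - p = xs k.+1 - p + d k.+1.
  by rewrite /d [RHS]addrC addrA subrK.
have -> : B (xs k.+2) - B p = B (xs k.+1) - B p + db k.+1.
  by rewrite /db [RHS]addrC addrA subrK.
apply: (energy_descent hH) => //; first exact: lipC.
have := maxA.1 _ _ _ _ (A_step k) Apv; rewrite vE opprK zsE addrAC.
congr (0 <= ip _ _).
have hBp : B p = lam^-1 *: (lam *: B p) by rewrite scalerK ?gt_eqF.
rewrite /u {1}hBp -scalerDr (scalerBr lam (B _)) (opprB (lam *: _)).
by congr (_ *: _); rewrite addrA [LHS](ACl (1*5*2*3*4)%AC).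
Qed.

(** Coercivity bounds [x_k - p], and the decrements vanish; then every energy term except that in
    [|x_k - p|^2] tends to 0, so this one converges with the energy. *)
Lemma fejer p : zero_of_sum A B p ->
  [/\ exists M, forall k, ip (xs k.+1 - p) (xs k.+1 - p) <= M,
      (fun k => ip (d k) (d k)) @ \oo --> (0 : R) &
      cvg ((fun k => ip (xs k.+1 - p) (xs k.+1 - p)) @ \oo)].
Proof.
move=> zp.
pose E k := energy ip alpha beta lam kappa (xs k.+1 - p) (d k) (B (xs k.+1) - B p) (db k).
pose phi k := ip (xs k.+1 - p) (B (xs k.+1) - B p).
pose W k := ip (xs k.+1 - p) (xs k.+1 - p).
pose D k := ip (d k) (d k).
pose eps := (2 - beta - alpha * beta - 2 * kappa) / (2 * beta).
pose del := (1 - alpha - kappa * beta) / 2.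
have eps0 : 0 < eps by rewrite divr_gt0 ?mulr_gt0 ?subr_gt0.
have del0 : 0 < del by rewrite divr_gt0 // subr_gt0.
have D0 k : 0 <= D k by exact: ip_ge0.
have phi0 k : 0 <= phi k by exact: monB.
have EW k : del * W k <= E k.
  by apply: (energy_ge hH) => //; exact: lipC.
have E0 k : 0 <= E k.
  by apply: le_trans (EW k); apply: mulr_ge0; [exact: ltW|exact: (ip_ge0 hH)].
have lb0 : 0 < lam * beta by rewrite mulr_gt0.
have S0 k : 0 <= eps * D k + lam * beta * phi k.
  by rewrite addr_ge0 // mulr_ge0 // ltW.
have step k : E k.+1 <= E k - (eps * D k.+1 + lam * beta * phi k.+1).
  exact: energy_step.
have [Ecvg Scvg] := lyapunov_cvg E0 S0 step.
have part (a : nat -> R) (s : R) : 0 < s -> (forall k, 0 <= a k) ->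
    (forall k, s * a k <= eps * D k + lam * beta * phi k) -> a @ \oo --> (0 : R).
  move=> s0 a0 ha.
  apply: (@squeeze_cvgr _ _ _ _ (fun=> 0)
    (fun k => s^-1 * (eps * D k + lam * beta * phi k))).
  - by apply: nearW => k; rewrite a0 /= -(ler_pM2l s0) mulVKf ?gt_eqF.
  - exact: cvg_cst.
  - by rewrite -[X in _ --> X](mulr0 s^-1); apply: cvgM => //; exact: cvg_cst.
have Dcvg : D @ \oo --> (0 : R).
  by apply: (part D eps) => // k; rewrite lerDl mulr_ge0 // ltW.
have phicvg : phi @ \oo --> (0 : R).
  by apply: (part phi (lam * beta)) => // k; rewrite lerDr mulr_ge0 // ltW.
have Edec k : E k <= E 0%N.
  elim: k => // k; apply: le_trans; apply: le_trans (step k) _.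
  by rewrite gerBl.
have WM k : W k <= E 0%N / del.
  by rewrite ler_pdivlMr // mulrC; apply: le_trans (Edec k).
split=> //; first by exists (E 0%N / del).
have ecvg : (fun k => ip (xs k.+1 - p) (e k)) @ \oo --> (0 : R).
  apply: (@cvg0_of_sqr_le _ _ _ _ _ D (E 0%N / del * kappa ^+ 2)) => // k.
  apply: le_trans (ip_cauchy_schwarz hH _ _) _; rewrite -mulrA.
  apply: ler_pM; [exact: (ip_ge0 hH)|exact: (ip_ge0 hH)|exact: WM|exact: lipC].
have a1 : 1 - alpha != 0 by rewrite subr_eq0 eq_sym lt_eqF.
have /cvg_ex[l El] := Ecvg.
(* The energy is solved for [|x_k - p|^2]; the zeros are the limits of its other terms. *)
apply/cvg_ex; exists (2 / (1 - alpha) * (l + 0 - kappa / (2 * beta) * 0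
  - lam * (1 - beta) * 0)).
have h : (fun k => 2 / (1 - alpha) * (E k + ip (xs k.+1 - p) (e k)
    - kappa / (2 * beta) * D k - lam * (1 - beta) * phi k)) @ \oo
  --> 2 / (1 - alpha) * (l + 0 - kappa / (2 * beta) * 0 - lam * (1 - beta) * 0).
  apply: cvgM; first exact: cvg_cst.
  apply: cvgB; last by apply: cvgM => //; exact: cvg_cst.
  apply: cvgB; last by apply: cvgM => //; exact: cvg_cst.
  exact: cvgD.
apply: cvg_eq1 h => k; rewrite /E /energy -/(e k) -/(D k) -/(W k) -/(phi k).
by field; rewrite a1 gt_eqF.
Qed.

Lemma weak_cluster_zero p (F : set_system nat) : zero_of_sum A B p ->
  UltraFilter F -> \oo `<=` F ->
  exists2 q, zero_of_sum A B q & forall v, (fun k => ip (xs k.+1) v) @ F --> ip q v.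
Proof.
move=> zp UF ooF; have PF : ProperFilter F by exact: ultra_proper.
have [[M WM] Dcvg _] := fejer zp.
have toF (a : nat -> R) l : a @ \oo --> l -> a @ F --> l.
  by apply: cvg_trans; exact: cvg_app.
(* The first two terms bound [|x_k|^2], the others [|B x_k|^2]; one constant serves both
   sequences. *)
pose M' := 2 * M + 2 * ip p p + (2 * (L ^+ 2 * M) + 2 * ip (B p) (B p)).
have M0 : 0 <= M by apply: le_trans (WM 0%N); exact: (ip_ge0 hH).
have LM0 : 0 <= L ^+ 2 * M by rewrite mulr_ge0 // sqr_ge0.
have XM k : ip (xs k.+1) (xs k.+1) <= M'.
  have := ip_add_le hH (xs k.+1 - p) p; rewrite subrK /M'.
  have := WM k; have := ip_ge0 hH (B p); lra.
have BM k : ip (B (xs k.+1)) (B (xs k.+1)) <= M'.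
  have := ip_add_le hH (B (xs k.+1) - B p) (B p); rewrite subrK /M'.
  have := lipB (xs k.+1) p; have := ip_ge0 hH p.
  have : L ^+ 2 * ip (xs k.+1 - p) (xs k.+1 - p) <= L ^+ 2 * M.
    by rewrite ler_wpM2l // sqr_ge0.
  lra.
have [q Xq] := ultra_weak_cvg hH UF XM.
have [w Bw] := ultra_weak_cvg hH UF BM.
have XBcvg : cvg ((fun k => ip (xs k.+1) (B (xs k.+1))) @ F).
  apply: (@ultra_bounded_cvg _ _ _ _ _ M') => // k.
  have := ip_young hH (B (xs k.+1)) (xs k.+1) ltr01.
  have := ip_young hH (- B (xs k.+1)) (xs k.+1) ltr01.
  have := XM k; have := BM k; rewrite ler_norml !(ipE hH) !divr1; lra.
have /cvg_ex[c hc] := XBcvg.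
have DS : (fun k => ip (d k.+1) (d k.+1)) @ \oo --> (0 : R).
  by rewrite (cvg_shiftS (fun k => ip (d k) (d k))).
exists q => //.
(* The residuals are [z_{k+1} - x_k = d k.+1 / beta] and [u k + B x_k = (- d k.+1 - e k) / (lam
   beta)]; both vanish because [d] does. *)
apply: (zero_of_weak_limit hH maxA monB L_gt0 lipB (X := fun k => xs k.+1)
  (Z := fun k => zs k.+1) A_step XM BM _ _ Xq Bw hc); apply: toF.
  apply: (@cvg_eq1 _ _ _ (fun k => beta^-1 ^+ 2 * ip (d k.+1) (d k.+1))).
    by move=> k; rewrite zsE [xs k.+1 + _]addrC addrK (ipZl hH) (ipZr hH) mulrA.
  by rewrite -[X in _ --> X](mulr0 (beta^-1 ^+ 2)); apply: cvgM => //; exact: cvg_cst.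
pose C := 2 * (lam^-1 * beta^-1) ^+ 2.
apply: (@squeeze_cvgr _ _ _ _ (fun=> 0)
  (fun k => C * (ip (d k.+1) (d k.+1) + kappa ^+ 2 * ip (d k) (d k)))).
- apply: nearW => k; rewrite (ip_ge0 hH) /=.
  have -> : u k + B (xs k.+1) = (lam^-1 * beta^-1) *: (- d k.+1 - e k).
    have hB : B (xs k.+1) = lam^-1 *: (lam *: B (xs k.+1)) by rewrite scalerK ?gt_eqF.
    have hde : beta^-1 *: (- d k.+1 - e k)
        = - (beta^-1 *: d k.+1) - (lam / beta) *: db k + (alpha / beta) *: d k.
      rewrite /e; move: (d k.+1) (db k) (d k) => x y z.
      rewrite scalerBr scalerN scalerBr opprB !scalerA ![beta^-1 * _]mulrC.
      by rewrite addrA addrAC.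
    rewrite {1}hB /u -scalerDr -(scalerA lam^-1 beta^-1) hde; congr (_ *: _).
    by rewrite [LHS](ACl (1*3*4*2*5)%AC) /= subrK.
  rewrite !(ipZl hH, ipZr hH) mulrA -expr2 /C -mulrA mulrCA ler_wpM2l ?sqr_ge0 //.
  apply: le_trans (ip_add_le hH _ _) _; rewrite !(ipNl hH, ipNr hH) !opprK -mulrDr.
  by rewrite ler_pM2l // lerD2l; exact: lipC.
- exact: cvg_cst.
- rewrite (_ : 0 = C * (0 + kappa ^+ 2 * 0)); last by ring.
  apply: cvgM; first exact: cvg_cst.
  by apply: cvgD => //; apply: cvgM => //; exact: cvg_cst.
Qed.

Lemma iteration_weakly_converges : (exists p, zero_of_sum A B p) ->
  exists p, zero_of_sum A B p /\ weakly_converges ip (fun k => xs k.+1) p.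
Proof.
move=> [p zp]; apply: (opial hH).
  by move=> q zq; have [] := fejer zq.
by move=> F UF ooF; exact: (weak_cluster_zero zp).
Qed.

End Iteration.

(** * Lipschitz constants of [lam B - alpha Id] *)

Section ForwardOperator.
Variables (R : realType) (H : lmodType R) (ip : H -> H -> R).
Hypothesis hH : is_hilbert ip.

Lemma ip_lincomb a c x b :
  ip (a *: b - c *: x) (a *: b - c *: x)
  = a ^+ 2 * ip b b - 2 * a * c * ip x b + c ^+ 2 * ip x x.
Proof. by rewrite !(ipE hH) (ip_sym hH b x); ring. Qed.

(** In the two expanded squares the cross term is nonpositive on the left, by monotonicity, and
    nonnegative on the right. *)
Lemma lipschitz_shift lam alpha L x b : 0 <= lam -> 0 <= alpha -> 0 <= L ->
  ip b b <= L ^+ 2 * ip x x -> 0 <= ip x b ->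
  ip (lam *: b - alpha *: x) (lam *: b - alpha *: x)
    <= (lam * L + alpha) ^+ 2 * ip x x.
Proof.
move=> lam0 alpha0 L0 hL hm; rewrite ip_lincomb.
have := ler_wpM2l (sqr_ge0 lam) hL.
have := mulr_ge0 (mulr_ge0 lam0 alpha0) hm.
have := mulr_ge0 (mulr_ge0 (mulr_ge0 lam0 alpha0) L0) (ip_ge0 hH x).
lra.
Qed.

(* [lam b] lies in the ball with diameter [0, lam L x], on which the distance
   to [alpha x] is largest at an end of that diameter. *)
Lemma cocoercive_shift lam alpha L kappa x b : 0 < lam -> 0 < L ->
  ip b b <= L ^+ 2 * ip x x -> ip b b <= L * ip x b ->
  kappa = Num.max (lam * L - alpha) alpha ->
  ip (lam *: b - alpha *: x) (lam *: b - alpha *: x) <= kappa ^+ 2 * ip x x.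
Proof.
move=> lam0 L0 hL hc kE; rewrite ip_lincomb.
have xb0 : 0 <= ip x b.
  by rewrite -(pmulr_rge0 _ L0); apply: le_trans hc; exact: (ip_ge0 hH).
have xbL : ip x b <= L * ip x x.
  have h : ip b b / L <= ip x b by rewrite ler_pdivrMr // mulrC.
  by have := ip_young hH b x L0; lra.
have h1 : lam ^+ 2 * ip b b <= lam ^+ 2 * (L * ip x b).
  by rewrite ler_wpM2l // sqr_ge0.
have lxb : 0 <= lam * ip x b by rewrite mulr_ge0 // ltW.
(* By [h1] the left side exceeds [alpha^2 |x|^2] by at most [(lam L - 2 alpha) lam <x, b>]; the sign
   of the first factor decides the case, and [xbL] serves when it is positive. *)
case: (leP (lam * L - alpha) alpha) kE => hla ->.
  have : 0 <= (2 * alpha - lam * L) * (lam * ip x b).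
    by rewrite mulr_ge0 // subr_ge0; lra.
  lra.
have : 0 <= (lam * L - 2 * alpha) * (lam * (L * ip x x - ip x b)).
  by rewrite !mulr_ge0 ?subr_ge0 //; lra.
lra.
Qed.

End ForwardOperator.
Unset Implicit Arguments.

(* xs k = x_{k-1}, i.e. xs 0 = x_{-1}, xs 1 = x_0; zs (k+1) = z_{k+1}. *)
Theorem theorem4p3 (R : realType) (H : lmodType R) (ip : H -> H -> R)
  (hH : is_hilbert ip) (A : H -> H -> Prop) (B : H -> H)
  (alpha beta lam L : R) (xs zs : nat -> H) :
  maximally_monotone ip A ->
  monotone_fun ip B ->
  (exists p, zero_of_sum A B p) ->
  0 <= alpha -> alpha < 1 -> 0 < beta -> beta <= 1 -> 0 < lam -> 0 < L ->
  ((lipschitz_op ip L B /\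
     lam < Num.min ((2 - beta - alpha * beta - 2 * alpha) / (2 * L))
                   ((1 - alpha - alpha * beta) / (beta * L)))
   \/
   (cocoercive_op ip L^-1 B /\ alpha < (2 - beta) / (2 + beta) /\
     lam < Num.min ((2 - beta - alpha * beta + 2 * alpha) / (2 * L))
                   ((1 - alpha + alpha * beta) / (beta * L)))) ->
  (forall k : nat,
     resolvent_rel lam A
       (xs k.+1 - lam *: B (xs k.+1) - (lam / beta) *: (B (xs k.+1) - B (xs k))
          + (alpha / beta) *: (xs k.+1 - xs k))
       (zs k.+1)) ->
  (forall k : nat, xs k.+2 = (1 - beta) *: xs k.+1 + beta *: zs k.+1) ->
  exists p, zero_of_sum A B p /\ weakly_converges ip (fun k => xs k.+1) p.
Proof.
move=> maxA monB zeros alpha0 alpha1 beta0 beta1 lam0 L0 hyp hres hrelax.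
have lamL0 : 0 < lam * L by rewrite mulr_gt0.
case: hyp => [[lipB]|[cocoB [halpha]]];
  rewrite lt_min !ltr_pdivlMr ?mulr_gt0 // => /andP[h1 h2].
  (* Multiplied out, the two bounds on [lam] are the descent and coercivity conditions for
     [kappa = lam L + alpha]. *)
  apply: (@iteration_weakly_converges _ _ _ hH A B alpha beta lam L
    (lam * L + alpha) xs zs) => //; [lra|..|lra|lra].
    by move=> x y; exact: (lipschitz_sqr hH).
  move=> x y; apply: (lipschitz_shift hH) => //; [exact: ltW|exact: ltW|].
  exact: (lipschitz_sqr hH).
(* This becomes [2 alpha < 2 - beta - alpha beta], the descent condition when [kappa = alpha]. *)
rewrite ltr_pdivlMr in halpha; last by lra.
have alpha_beta : alpha * beta < 1 - alpha.
  have [|h] := ltP (alpha * beta) (1 - alpha) => //.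
  (* By [h] and [halpha], [alpha < 1 - beta]; but [h] also bounds this product by [- beta^2]. *)
  have : 0 < (1 - beta - alpha) * (1 + beta) by rewrite mulr_gt0; lra.
  have := sqr_ge0 beta; lra.
apply: (@iteration_weakly_converges _ _ _ hH A B alpha beta lam L
  (Num.max (lam * L - alpha) alpha) xs zs) => //.
(* When [alpha = 0] the maximum is [lam L], which is positive. *)
- by rewrite lt_max; case: (ltP 0 alpha) => h; rewrite ?orbT // orbF; lra.
- by move=> x y; exact: (cocoercive_lipschitz_sqr hH).
- move=> x y; apply: (cocoercive_shift hH lam0 L0) => //.
    exact: (cocoercive_lipschitz_sqr hH).
  by have := cocoB x y; rewrite (ipnorm_sqr hH) ler_pdivrMl.
- by case: (leP (lam * L - alpha) alpha) => _; lra.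
- by case: (leP (lam * L - alpha) alpha) => _; lra.
Qed.
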